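(* Let $L$ be a finite lattice and $P$ a finite non-empty poset. If $L$ has a lower semimodular coatom $c$, then for every proper join-irreducible $a$ of $L$ with $a \not\leq c$, the pair $(L,a)$ has the top downward matching property for $P$, where the matchings can be taken to be $a$-invertible. That is, for every filter $F$ of $P$ there is an $a$-invertible decreasing matching $\sigma : \mathrm{T}(L^P, P, a) \to \mathrm{T}(L^P, F, a)$.
   Context: A coatom is an element covered by the greatest element $\hat{1}$. An element $u \in L$ is lower semimodular iff for all $v, w \in L$ such that $v$ covers $u$, either $v \wedge w$ covers $u \wedge w$ or $v \wedge w = u \wedge w$. An element $a$ is join-irreducible iff $a = v \vee w$ implies $a = v$ or $a = w$; it is proper iff $a \neq \hat{0}$. $L^P$ is the set of order-preserving maps from $P$ to $L$, ordered pointwise. A filter of $P$ is an up-closed subset (possibly empty). For a filter $F$ of $P$ and a join-irreducible $a$, $\mathrm{T}(L^P, F, a) = \{f \in L^P \mid \text{for all } x \in P:\ f(x) \geq a \text{ iff } x \in F\}$. A decreasing matching from $Q_1$ to $Q_2$ (subsets of a poset) is a one-to-one map $\sigma: Q_1 \to Q_2$ with $\sigma(x) \leq x$ for all $x \in Q_1$. The pair $(L,a)$ has the top downward matching property for $P$ iff $a$ is join-irreducible and for every filter $F$ of $P$ there is a decreasing matching $\mathrm{T}(L^P, P, a) \to \mathrm{T}(L^P, F, a)$. A decreasing matching $\sigma : \mathrm{T}(L^P, F, a) \to \mathrm{T}(L^P, G, a)$ is $a$-invertible iff for every $f \in \mathrm{T}(L^P, F, a)$: $f(x) = \sigma(f)(x)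 \vee a$ for $x \in F$ and $f(x) = \sigma(f)(x)$ for $x \in P \setminus F$. *)

(* Defs.v *)
From HB Require Import structures.
From mathcomp Require Import all_boot all_order.

Set Implicit Arguments.
Unset Strict Implicit.
Unset Printing Implicit Defensive.

Import Order.TTheory.
Local Open Scope order_scope.

Definition covers (d : Order.disp_t) (T : porderType d) (v u : T) : Prop :=
  u < v /\ forall z : T, ~ (u < z /\ z < v).

Definition coatom (d : Order.disp_t) (L : finTBLatticeType d) (c : L) : Prop :=
  covers \top c.

Definition lower_semimodular (d : Order.disp_t) (L : latticeType d) (u : L) :
    Prop :=
  forall v w : L, covers v u ->
    covers (v `&` w) (u `&` w) \/ v `&` w = u `&` w.

(* The bottom element is join-irreducible in this sense. *)
Definition join_irreducible (d : Order.disp_t) (L : latticeType d) (a : L) :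
    Prop :=
  forall v w : L, a = v `|` w -> a = v \/ a = w.

Definition proper_elt (d : Order.disp_t) (L : finTBLatticeType d) (a : L) : Prop :=
  a <> \bot.

Definition is_filter (d : Order.disp_t) (P : finPOrderType d) (F : {set P}) :
    Prop :=
  forall x y : P, x <= y -> x \in F -> y \in F.

(* [opmap P L] is the poset L^P. *)
Record opmap (dP dL : Order.disp_t) (P : finPOrderType dP)
    (L : finPOrderType dL) := OpMap {
  opmap_val :> {ffun P -> L};
  _ : [forall x : P, forall y : P, (x <= y) ==> (opmap_val x <= opmap_val y)]
}.

Section OpMapOrder.
Context (dP dL : Order.disp_t) (P : finPOrderType dP) (L : finPOrderType dL).

HB.instance Definition _ := [isSub for @opmap_val dP dL P L].
HB.instance Definition _ := [Finite of opmap P L by <:].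

Lemma opmap_homo (f : opmap P L) : {homo f : x y / x <= y}.
Proof. by case: f => f /= /forallP H x y xy; exact: implyP (forallP (H x) y) xy. Qed.

Definition opmap_le (f g : opmap P L) : bool :=
  [forall x : P, f x <= g x].

Fact opmap_le_refl : reflexive opmap_le.
Proof. by move=> f; apply/forallP. Qed.

Fact opmap_le_anti : antisymmetric opmap_le.
Proof.
move=> f g /andP[/forallP fg /forallP gf]; apply/val_inj/ffunP => x /=.
by apply/le_anti; rewrite fg gf.
Qed.

Fact opmap_le_trans : transitive opmap_le.
Proof.
move=> g f h /forallP fg /forallP gh; apply/forallP => x.
exact: le_trans (fg x) (gh x).
Qed.

HB.instance Definition _ := Order.Le_isPOrder.Build dL (opmap P L)
  opmap_le_refl opmap_le_anti opmap_le_trans.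

Lemma opmap_leP (f g : opmap P L) : reflect (forall x : P, f x <= g x) (f <= g).
Proof. exact: forallP. Qed.

End OpMapOrder.

Definition Tset (dP dL : Order.disp_t) (P : finPOrderType dP)
    (L : finPOrderType dL) (F : {set P}) (a : L) : {set opmap P L} :=
  [set f : opmap P L | [forall x : P, (a <= f x) == (x \in F)]].

(* A map from Q1 to Q2 is given by a function on the ambient poset; only its
   values on Q1 matter. *)
Definition decreasing_matching (d : Order.disp_t) (T : finPOrderType d)
    (Q1 Q2 : {set T}) (sigma : T -> T) : Prop :=
  [/\ {in Q1, forall x, sigma x \in Q2},
      {in Q1 &, injective sigma} &
      {in Q1, forall x, sigma x <= x}].

Definition top_downward_matching_property (dP dL : Order.disp_t)
    (P : finPOrderType dP) (L : finLatticeType dL) (a : L) : Prop :=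
  join_irreducible a /\
  forall F : {set P}, is_filter F ->
    exists sigma : opmap P L -> opmap P L,
      decreasing_matching (Tset [set: P] a) (Tset F a) sigma.

(* The codomain T(L^P, G, a) of the matching does not occur in the condition. *)
Definition a_invertible (dP dL : Order.disp_t) (P : finPOrderType dP)
    (L : finLatticeType dL) (F : {set P}) (a : L)
    (sigma : opmap P L -> opmap P L) : Prop :=
  {in Tset F a, forall f : opmap P L,
    (forall x, x \in F -> f x = sigma f x `|` a) /\
    (forall x, x \notin F -> f x = sigma f x)}.

Arguments top_downward_matching_property {dP dL} P {L} a.

(* Main.v *)
(** The matching sends [f] to the map equal to [f] on [F] and to the pointwise
    meet of [f] with [c] off [F].  If [a <= w], then [w] is not below [c], so
    lower semimodularity of [c] makes [w] cover [c `&` w]; joining with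
    [a] escapes [c] and hence restores [w].  Thus [f] is recovered by
    joining its image with [a], which also gives injectivity. *)
Require Import Defs.
From mathcomp Require Import all_boot all_order.
Import Order.TTheory.
Local Open Scope order_scope.

Lemma meet_coatom_joinK {d : Order.disp_t} {L : finTBLatticeType d} {c a w : L} :
  coatom c -> lower_semimodular c -> ~~ (a <= c) -> a <= w ->
  (w `&` c) `|` a = w.
Proof.
move=> hc hcs hac aw.
(* Semimodularity is applied to [\top], which covers [c]. The degenerate alternative, treated first,
   puts [w] below [c], hence also [a]. *)
have [[_ nobetween]|] := hcs _ w hc; last first.
  rewrite meet1x => wc; case/negP: hac.
  by rewrite (le_trans aw) // wc leIl.
have := leUx (w `&` c) a w; rewrite leIl aw le_eqVlt => /orP[/eqP //|ltw].
(* A join strictly below [w] would contradict the covering: it also lies strictly above the meet of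
   [w] and [c], since equality there would force [a <= c]. *)
case: (nobetween ((w `&` c) `|` a)); rewrite meet1x meetC; split => //.
rewrite lt_neqAle leUl andbT eq_sym; apply: contra hac => /eqP Ewc.
by rewrite (le_trans _ (leIr c w)) // -Ewc leUr.
Qed.

Section MeetOff.
Context {dP dL : Order.disp_t} {P : finPOrderType dP} {L : finTBLatticeType dL}.
Variables (F : {set P}) (c : L).
Hypothesis hF : is_filter F.

Definition meet_off_fun (f : opmap P L) : {ffun P -> L} :=
  [ffun x => if x \in F then f x else f x `&` c].

(** Since [F] is up-closed, the one harmful case, [x] in [F] below [y] outside [F], cannot occur. *)
Fact meet_off_homo (f : opmap P L) :
  [forall x, forall y, (x <= y) ==> (meet_off_fun f x <= meet_off_fun f y)].
Proof.
apply/forallP => x; apply/forallP => y; apply/implyP => xy.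
have fxy := opmap_homo f xy; rewrite !ffunE.
have [xF|xF] := boolP (x \in F); first by rewrite (hF _ _ xy xF).
by case: ifP => _; [exact: le_trans (leIl _ _) fxy | exact: leI2].
Qed.

Definition meet_off (f : opmap P L) : opmap P L := OpMap (meet_off_homo f).

Lemma meet_offE (f : opmap P L) (x : P) :
  meet_off f x = if x \in F then f x else f x `&` c.
Proof. by rewrite ffunE. Qed.

Lemma meet_off_le (f : opmap P L) : meet_off f <= f.
Proof. by apply/opmap_leP => x; rewrite meet_offE; case: ifP => // _; exact: leIl. Qed.

Lemma Tset_setT_le {a : L} {f : opmap P L} :
  f \in Tset [set: P] a -> forall x, a <= f x.
Proof. by rewrite inE => /forallP fT x; rewrite (eqP (fT x)) inE. Qed.

(** Values on [F] are unchanged and stay above [a]; off [F] they lie below [c], and [a] does not. *)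
Lemma meet_off_Tset (a : L) (f : opmap P L) :
  ~~ (a <= c) -> f \in Tset [set: P] a -> meet_off f \in Tset F a.
Proof.
move=> hac /Tset_setT_le af; rewrite inE; apply/forallP => x; rewrite meet_offE.
by case: ifP => _; rewrite ?af // lexI (negbTE hac) andbF.
Qed.

Lemma meet_off_joinK (a : L) (f : opmap P L) :
  coatom c -> lower_semimodular c -> ~~ (a <= c) ->
  f \in Tset [set: P] a -> forall x, f x = meet_off f x `|` a.
Proof.
move=> hc hcs hac /Tset_setT_le af x; rewrite meet_offE; case: ifP => _.
  by rewrite (join_l (af x)).
by rewrite (meet_coatom_joinK hc hcs hac (af x)).
Qed.

End MeetOff.

Theorem theorem4p7p4 (dL dP : Order.disp_t) (L : finTBLatticeType dL)
    (P : finPOrderType dP) (hP : (0 < #|P|)%N)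
    (c : L) (hc : coatom c) (hcs : lower_semimodular c)
    (a : L) (ha : join_irreducible a) (ha0 : proper_elt a) (hac : ~~ (a <= c)) :
  top_downward_matching_property P a /\
  forall F : {set P}, is_filter F ->
    exists sigma : opmap P L -> opmap P L,
      decreasing_matching (Tset [set: P] a) (Tset F a) sigma /\
      a_invertible [set: P] a sigma.
Proof.
suff matching (F : {set P}) : is_filter F ->
    exists sigma : opmap P L -> opmap P L,
      decreasing_matching (Tset [set: P] a) (Tset F a) sigma /\
      a_invertible [set: P] a sigma.
  split=> //; split=> // F /matching[sigma [dm _]]; by exists sigma.
move=> hF; have joinK := meet_off_joinK F c hF a _ hc hcs hac.
exists (meet_off F c hF); split; first split.
- by move=> f; exact: meet_off_Tset.
- move=> f g fT gT fg; apply/val_inj/ffunP => x /=.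
  by rewrite (joinK f fT x) fg -(joinK g gT x).
- by move=> f _; exact: meet_off_le.
(* The source filter is all of [P], so the clause about points outside it is vacuous. *)
- by move=> f fT; split=> x; [rewrite -joinK | rewrite inE].
Qed.
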